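(* For any weak composition $\alpha=(\alpha_1,\ldots,\alpha_n)\in\mathbb{Z}_{\ge0}^n$, \begin{align*} \kappa_\alpha(1,\ldots,1)\ \ge\ \theta_{D(\alpha)}\ \ge\ & 1+\sum_{(i_1,i_2)\in\mathrm{inv}_1(\alpha)}(\alpha_{i_2}-\alpha_{i_1})+\sum_{(i_1,i_2,i_3)\in\mathrm{inv}_2(\alpha)}(\alpha_{i_2}-\alpha_{i_3})(\alpha_{i_3}-\alpha_{i_1})\\ &+\sum_{(i_1,i_2,i_3,i_4)\in\mathrm{inv}_3(\alpha)}(\alpha_{i_2}-\alpha_{i_1})(\alpha_{i_4}-\alpha_{i_3}), \end{align*} where $\mathrm{inv}_1(\alpha)=\{(i_1,i_2): i_1<i_2,\ \alpha_{i_1}<\alpha_{i_2}\}$, $\mathrm{inv}_2(\alpha)=\{(i_1,i_2,i_3): i_1<i_2<i_3,\ \alpha_{i_1}<\alpha_{i_3}<\alpha_{i_2}\}$, and $\mathrm{inv}_3(\alpha)=\{(i_1,i_2,i_3,i_4): i_1<i_2<i_3<i_4,\ \alpha_{i_1}<\alpha_{i_2},\ \alpha_{i_3}<\alpha_{i_4}\}$.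
   Context: Key polynomials are defined recursively: if $\alpha_1\ge\cdots\ge\alpha_n$, $\kappa_\alpha(x)=x^\alpha=x_1^{\alpha_1}\cdots x_n^{\alpha_n}$; otherwise choose $i$ with $\alpha_i<\alpha_{i+1}$ and set $\kappa_\alpha(x)=\partial_i\,x_i\,\kappa_{s_i\alpha}(x)$, where $s_i\alpha$ swaps $\alpha_i,\alpha_{i+1}$ and $\partial_i f=\frac{f-f|_{x_i\leftrightarrow x_{i+1}}}{x_i-x_{i+1}}$. The skyline diagram $D(\alpha)$ is the set of boxes $\{(i,j):1\le j\le\alpha_i\}$ (row $i$, column $j$). $\theta_{D(\alpha)}$ denotes the number of supports of the dual character of the flagged Weyl module of $D(\alpha)$, which equals $\kappa_\alpha(x)$; i.e. $\theta_{D(\alpha)}$ is the number of exponent vectors $\beta$ such that $x^\beta$ has nonzero coefficient in $\kappa_\alpha(x)$. *)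

(* Defs.v *)
From HB Require Import structures.
From mathcomp Require Import all_boot all_order all_fingroup all_algebra.
From mathcomp Require Import ring zify.
From mathcomp.multinomials Require Import mpoly.

Set Implicit Arguments.
Unset Strict Implicit.
Unset Printing Implicit Defensive.
Import GRing.Theory.
Local Open Scope ring_scope.

(* A weak composition of length n is an element of 'X_{1..n}, the type of     *)
(* functions 'I_n -> nat that mpoly uses for exponent vectors.  Row and       *)
(* variable indices start at 0.                                               *)

Section Inversions.
Variables (n : nat) (a : 'X_{1..n}).

Definition inv1 : {set 'I_n * 'I_n} :=
  [set p : 'I_n * 'I_n | let: (i1, i2) := p in (i1 < i2)%N && (a i1 < a i2)%N].

Definition inv2 : {set 'I_n * 'I_n * 'I_n} :=
  [set p : 'I_n * 'I_n * 'I_n | let: (i1, i2, i3) := p in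
     [&& (i1 < i2)%N, (i2 < i3)%N, (a i1 < a i3)%N & (a i3 < a i2)%N]].

Definition inv3 : {set 'I_n * 'I_n * 'I_n * 'I_n} :=
  [set p : 'I_n * 'I_n * 'I_n * 'I_n | let: (i1, i2, i3, i4) := p in
     [&& (i1 < i2)%N, (i2 < i3)%N, (i3 < i4)%N,
         (a i1 < a i2)%N & (a i3 < a i4)%N]].

Definition ascent (i j : 'I_n) : bool := (j == i.+1 :> nat) && (a i < a j)%N.

Definition mswap (i j : 'I_n) : 'X_{1..n} :=
  [multinom a (tperm i j k) | k < n].

End Inversions.

Section DividedDifference.
Variable n : nat.
Implicit Types (f g : {mpoly int[n]}) (i j k l : 'I_n) (a : 'X_{1..n}).

Definition pswap i j f : {mpoly int[n]} := msym (tperm i j) f.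

Lemma pswapM i j f g : pswap i j (f * g) = pswap i j f * pswap i j g.
Proof. exact: msymM. Qed.

Lemma pswapB i j f g : pswap i j (f - g) = pswap i j f - pswap i j g.
Proof. exact: msymB. Qed.

Lemma pswapX i j k : pswap i j 'X_k = 'X_(tperm i j k).
Proof.
rewrite /pswap msymX; congr ('X_[_]); apply/mnmP => l.
rewrite mnmE !mnm1E tpermV; congr (nat_of_bool _).
by rewrite -(inj_eq (@perm_inj _ (tperm i j))) tpermK.
Qed.

Lemma pswapK i j : involutive (pswap i j).
Proof. by move=> f; rewrite /pswap -msymMm tperm2 msym1m. Qed.

Lemma ddiff_exists i j f :
  exists h : {mpoly int[n]}, h * ('X_i - 'X_j) == f - pswap i j f.
Proof.
pose P f := exists h : {mpoly int[n]}, h * ('X_i - 'X_j) = f - pswap i j f.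
suff: P f by case=> h /eqP hE; exists h.
have PD p q : P p -> P q -> P (p + q).
  move=> [u uE] [v vE]; exists (u + v).
  by rewrite mulrDl uE vE /pswap msymD; ring.
have PM p q : P p -> P q -> P (p * q).
  move=> [u uE] [v vE]; exists (p * v + u * pswap i j q).
  rewrite pswapM mulrDl -mulrA vE mulrAC uE; ring.
have PC c : P c%:MP.
  by exists 0; rewrite mul0r /pswap -[c%:MP]mulr1 mul_mpolyC msymZ msym1 subrr.
have PX k : P 'X_k.
  rewrite /P pswapX; case: tpermP => [->|->|_ _]; last by exists 0; ring.
  - by exists 1; ring.
  - by exists (-1); ring.
elim/mpolyind: f => [|c m p _ _ IH]; first by rewrite -mpolyC0.
apply: PD => //; rewrite -mul_mpolyC; apply: (PM) => //.
rewrite mpolyXE_id; apply: (big_ind P) => [|u v|k _]; [by rewrite -mpolyC1|exact: (PM)|].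
by elim: (m k) => [|e IHe]; rewrite ?expr0 -?mpolyC1 // exprS; apply: PM.
Qed.

(* The quotient (f - pswap i j f) / ('X_i - 'X_j), which is unique for        *)
(* i != j since {mpoly int[n]} is an integral domain.                         *)
Definition ddiff i j f : {mpoly int[n]} := xchoose (ddiff_exists i j f).

Lemma ddiffP i j f : ddiff i j f * ('X_i - 'X_j) = f - pswap i j f.
Proof. exact/eqP/(xchooseP (ddiff_exists i j f)). Qed.

Definition demazure i j f : {mpoly int[n]} := ddiff i j ('X_i * f).

(* The fuel d is enough as soon as #|inv1 a| <= d; key_dominant and           *)
(* key_ascent below show that key satisfies the defining recursion for every  *)
(* choice of ascent.                                                          *)
Fixpoint key_rec (d : nat) a : {mpoly int[n]} :=
  if d is d'.+1 then
    if [pick p : 'I_n * 'I_n | ascent a p.1 p.2] is Some p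
    then ddiff p.1 p.2 ('X_(p.1) * key_rec d' (mswap a p.1 p.2))
    else 'X_[a]
  else 'X_[a].

Definition key a : {mpoly int[n]} := key_rec #|inv1 a| a.

(* The dual character of the flagged Weyl module of the skyline diagram D(a)  *)
(* is key a, so this is theta_{D(a)}; msupp is duplicate-free.                *)
Definition theta a : nat := size (msupp (key a)).

End DividedDifference.

Section KeyRecursion.
Variable n : nat.
Implicit Types (f g : {mpoly int[n]}) (i j k l : 'I_n) (a : 'X_{1..n}).

Lemma mpolyXB_neq0 i j : i != j -> 'X_i - 'X_j != 0 :> {mpoly int[n]}.
Proof.
move=> ij; rewrite subr_eq0; apply/eqP => /(congr1 (mcoeff U_(i))).
rewrite !mcoeffX eqxx; case: eqP => // /mnmP/(_ i).
by rewrite !mnm1E eqxx eq_sym (negbTE ij).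
Qed.

Lemma demazureE i j f : demazure i j f = ddiff i j ('X_i * f).
Proof. by []. Qed.

Lemma demazureP i j f :
  demazure i j f * ('X_i - 'X_j) = 'X_i * f - 'X_j * pswap i j f.
Proof. by rewrite ddiffP pswapM pswapX tpermL. Qed.

Lemma tpermDn i j k : i != j -> i != k -> tperm j k i = i.
Proof. by move=> ij ik; rewrite tpermD // eq_sym. Qed.

Lemma tperm_comm i j k l x : i != k -> i != l -> j != k -> j != l ->
  tperm i j (tperm k l x) = tperm k l (tperm i j x).
Proof.
move=> ik il jk jl; have [ki li kj lj] : [/\ k != i, l != i, k != j & l != j].
  by rewrite ![_ == i]eq_sym ![_ == j]eq_sym.
have Di : tperm k l i = i by exact: tpermDn.
have Dj : tperm k l j = j by exact: tpermDn.
have Dk : tperm i j k = k by exact: tpermDn.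
have Dl : tperm i j l = l by exact: tpermDn.
have [->|xi] := eqVneq x i; first by rewrite Di tpermL Dj.
have [->|xj] := eqVneq x j; first by rewrite Dj tpermR Di.
have [->|xk] := eqVneq x k; first by rewrite Dk tpermL Dl.
have [->|xl] := eqVneq x l; first by rewrite Dl tpermR Dk.
have Dij : tperm i j x = x by exact: tpermDn.
have Dkl : tperm k l x = x by exact: tpermDn.
by rewrite Dij Dkl.
Qed.

Lemma pswap_comm i j k l f : i != k -> i != l -> j != k -> j != l ->
  pswap i j (pswap k l f) = pswap k l (pswap i j f).
Proof.
move=> ik il jk jl; rewrite /pswap -!msymMm; congr (msym _ f).
by apply/permP => x; rewrite !permM tperm_comm.
Qed.

Lemma tperm_braid i j k x : i != j -> i != k -> j != k ->
  tperm i j (tperm j k (tperm i j x)) = tperm j k (tperm i j (tperm j k x)).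
Proof.
move=> ij ik jk; have [ji ki kj] : [/\ j != i, k != i & k != j].
  by rewrite ![_ == i]eq_sym [k == j]eq_sym.
have Di : tperm j k i = i by exact: tpermDn.
have Dk : tperm i j k = k by exact: tpermDn.
have [->|xi] := eqVneq x i; first by rewrite Di !(tpermL, tpermR) Dk.
have [->|xj] := eqVneq x j; first by rewrite !(tpermL, tpermR) Di Dk !(tpermL, tpermR).
have [->|xk] := eqVneq x k; first by rewrite Dk !(tpermL, tpermR) Di.
have Dij : tperm i j x = x by exact: tpermDn.
have Djk : tperm j k x = x by exact: tpermDn.
by rewrite !(Dij, Djk).
Qed.

Lemma pswap_braid i j k f : i != j -> i != k -> j != k ->
  pswap i j (pswap j k (pswap i j f)) = pswap j k (pswap i j (pswap j k f)).
Proof.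
move=> ij ik jk; rewrite /pswap -!msymMm; congr (msym _ f).
by apply/permP => x; rewrite !permM tperm_braid.
Qed.

Lemma braid_identity (R : comNzRingType) (a b c : R) (f f1 f2 f12 f21 f121 : R)
    (g g2 g12 h h1 p g' g1' g21' h' h2' p' : R) :
  g * (a - b) = a * f - b * f1 -> g2 * (a - c) = a * f2 - c * f21 ->
  g12 * (b - c) = b * f12 - c * f121 ->
  h * (b - c) = b * g - c * g2 -> h1 * (a - c) = a * g - c * g12 ->
  p * (a - b) = a * h - b * h1 ->
  g' * (b - c) = b * f - c * f2 -> g1' * (a - c) = a * f1 - c * f12 ->
  g21' * (a - b) = a * f21 - b * f121 ->
  h' * (a - b) = a * g' - b * g1' -> h2' * (a - c) = a * g' - c * g21' ->
  p' * (b - c) = b * h' - c * h2' ->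
  p * (a - b) * (a - c) * (b - c) = p' * (a - b) * (a - c) * (b - c).
Proof.
move=> Eg T1 T3 Eh T2 Ep Eg' T1' T3' Eh' T2' Ep'.
transitivity (a * b * (g * (a - b))
  - a * c * (g2 * (a - c)) + b * c * (g12 * (b - c))).
  rewrite Ep.
  transitivity (a * (a - c) * (h * (b - c)) - b * (b - c) * (h1 * (a - c)));
    first by ring.
  by rewrite Eh T2; ring.
rewrite Eg T1 T3.
transitivity (a * a * (g' * (b - c))
  - b * b * (g1' * (a - c)) + c * c * (g21' * (a - b))).
  by rewrite Eg' T1' T3'; ring.
transitivity ((p' * (b - c)) * (a - b) * (a - c)); last by ring.
rewrite Ep'.
transitivity (b * (a - c) * (h' * (a - b)) - c * (a - b) * (h2' * (a - c)));
  last by ring.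
by rewrite Eh' T2'; ring.
Qed.

Lemma comm_identity (R : comNzRingType) (u v : R) (a b c d f f1 f2 f12 : R)
    (g g1 h h2 : R) :
  g * (c - d) = c * f - d * f2 -> g1 * (c - d) = c * f1 - d * f12 ->
  h * (a - b) = a * f - b * f1 -> h2 * (a - b) = a * f2 - b * f12 ->
  u * (a - b) = a * g - b * g1 -> v * (c - d) = c * h - d * h2 ->
  u * (a - b) * (c - d) = v * (a - b) * (c - d).
Proof.
move=> Eg Eg1 Eh Eh2 -> Ev; rewrite [RHS]mulrAC Ev.
transitivity (a * (g * (c - d)) - b * (g1 * (c - d))); first by ring.
rewrite Eg Eg1.
transitivity (c * (h * (a - b)) - d * (h2 * (a - b))); last by ring.
by rewrite Eh Eh2; ring.
Qed.

#[local] Opaque pswap demazure.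

Definition is_demazure i j f g :=
  g * ('X_i - 'X_j) = 'X_i * f - 'X_j * pswap i j f.

Lemma is_demazure_swap i j k l f g : is_demazure k l f g ->
  pswap i j g * ('X_(tperm i j k) - 'X_(tperm i j l))
  = 'X_(tperm i j k) * pswap i j f - 'X_(tperm i j l) * pswap i j (pswap k l f).
Proof.
move=> /(congr1 (pswap i j)).
by rewrite pswapM (pswapB _ _ 'X_k) pswapB 2!pswapM !pswapX.
Qed.

Lemma is_demazure_sym i j f g : i != j -> is_demazure i j f g -> pswap i j g = g.
Proof.
move=> ij E; apply: (mulIf (mpolyXB_neq0 ij)); rewrite E.
have := is_demazure_swap i j E; rewrite tpermL tpermR pswapK => E'.
by rewrite -[LHS]opprK -mulrN opprB E' opprB.
Qed.

Lemma demazure_comm i j k l f :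
  i != j -> k != l -> i != k -> i != l -> j != k -> j != l ->
  demazure i j (demazure k l f) = demazure k l (demazure i j f).
Proof.
move=> ij kl ik il jk jl.
have [ki li kj lj] : [/\ k != i, l != i, k != j & l != j].
  by rewrite ![_ == i]eq_sym ![_ == j]eq_sym.
apply: (mulIf (mpolyXB_neq0 ij)); apply: (mulIf (mpolyXB_neq0 kl)).
have G1 := is_demazure_swap i j (demazureP k l f).
have G2 := is_demazure_swap k l (demazureP i j f).
have Di : tperm k l i = i by exact: tpermDn.
have Dj : tperm k l j = j by exact: tpermDn.
have Dk : tperm i j k = k by exact: tpermDn.
have Dl : tperm i j l = l by exact: tpermDn.
rewrite Dk Dl (pswap_comm f ik il jk jl) in G1; rewrite Di Dj in G2.
exact: (comm_identity (demazureP k l f) G1 (demazureP i j f) G2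
         (demazureP _ _ _) (demazureP _ _ _)).
Qed.

Lemma is_demazure_braid i j k f g h p g' h' p' :
    i != j -> i != k -> j != k ->
    is_demazure i j f g -> is_demazure j k g h -> is_demazure i j h p ->
    is_demazure j k f g' -> is_demazure i j g' h' -> is_demazure j k h' p' ->
  p = p'.
Proof.
move=> ij ik jk Eg Eh Ep Eg' Eh' Ep'.
apply: (mulIf (mpolyXB_neq0 ij)); apply: (mulIf (mpolyXB_neq0 ik)).
apply: (mulIf (mpolyXB_neq0 jk)).
have [ji ki kj] : [/\ j != i, k != i & k != j].
  by rewrite ![_ == i]eq_sym [k == j]eq_sym.
have sg := is_demazure_sym ij Eg; have sg' := is_demazure_sym jk Eg'.
have Di : tperm j k i = i by exact: tpermDn.
have Dk : tperm i j k = k by exact: tpermDn.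
have T1 := is_demazure_swap j k Eg; rewrite Di tpermL in T1.
have T2 := is_demazure_swap i j Eh; rewrite tpermR Dk sg in T2.
have T1' := is_demazure_swap i j Eg'; rewrite Dk tpermR in T1'.
have T2' := is_demazure_swap j k Eh'; rewrite Di tpermL sg' in T2'.
have T3 := congr1 (pswap i j) T1; have T3' := congr1 (pswap j k) T1'.
rewrite pswapM !pswapB 2!pswapM !pswapX Dk tpermL in T3.
rewrite (pswap_braid f ij ik jk) in T3.
rewrite pswapM !pswapB 2!pswapM !pswapX Di tpermR in T3'.
exact: (braid_identity Eg T1 T3 Eh T2 Ep Eg' T1' T3' Eh' T2' Ep').
Qed.

Lemma demazure_braid i j k f : i != j -> i != k -> j != k ->
  demazure i j (demazure j k (demazure i j f))
  = demazure j k (demazure i j (demazure j k f)).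
Proof.
by move=> ij ik jk; apply: (is_demazure_braid ij ik jk); apply: demazureP.
Qed.

Lemma ascentW a i j : ascent a i j -> (i < j)%N /\ (a i < a j)%N.
Proof. by case/andP => /eqP -> ->. Qed.

Lemma ascent_neq a i j : ascent a i j -> i != j.
Proof. by case/ascentW => ij _; apply: contraTneq ij => ->; rewrite ltnn. Qed.

Lemma inv1_mswap a i j : ascent a i j -> (#|inv1 (mswap a i j)| < #|inv1 a|)%N.
Proof.
move=> /andP[/eqP jE aij].
pose t (p : 'I_n * 'I_n) := (tperm i j p.1, tperm i j p.2).
have t_inj : injective t by move=> [u v] [x y] [/perm_inj -> /perm_inj ->].
have ijP : (i, j) \in inv1 a by rewrite inE jE ltnSn.
rewrite (cardsD1 (i, j) (inv1 a)) ijP add1n ltnS.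
rewrite -(card_imset (mem (inv1 (mswap a i j))) t_inj).
apply/subset_leq_card/subsetP => q /imsetP[[u v] uvP ->{q}].
move: uvP; rewrite !inE /t !mnmE /= => /andP[uv auv]; rewrite auv andbT xpair_eqE.
case: (tpermP i j u) uv auv => [->|->|/eqP + /eqP +];
  case: (tpermP i j v) => [->|->|/eqP + /eqP +];
  move: aij; rewrite -?val_eqE /= ?eqxx; lia.
Qed.

Lemma key_rec0 a : key_rec 0 a = 'X_[a].
Proof. by []. Qed.

Lemma key_recS d a : key_rec d.+1 a =
  if [pick p : 'I_n * 'I_n | ascent a p.1 p.2] is Some p
  then demazure p.1 p.2 (key_rec d (mswap a p.1 p.2)) else 'X_[a].
Proof. by []. Qed.

Lemma keyE a : key a = key_rec #|inv1 a| a.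
Proof. by []. Qed.

#[local] Opaque key_rec key.

Lemma key_rec_fuel a d e : (#|inv1 a| <= d)%N -> (#|inv1 a| <= e)%N ->
  key_rec d a = key_rec e a.
Proof.
have no_asc (b : 'X_{1..n}) p : (#|inv1 b| <= 0)%N -> ascent b p.1 p.2 -> False.
  rewrite leqn0 cards_eq0 => /eqP b0 /ascentW[ij aij].
  by have := in_set0 (p.1, p.2); rewrite -b0 inE ij aij.
elim: d e a => [|d IH] [|e] a.
- by [].
- move=> /no_asc a0 _; rewrite key_rec0 key_recS.
  by case: pickP => [p /a0|].
- move=> _ /no_asc a0; rewrite key_rec0 key_recS.
  by case: pickP => [p /a0|].
- move=> ad ae; rewrite !key_recS; case: pickP => [p asc|//].
  have lt := inv1_mswap asc.
  by rewrite (IH e (mswap a p.1 p.2)) // -ltnS (leq_trans lt).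
Qed.

Lemma key_pick a : key a =
  if [pick p : 'I_n * 'I_n | ascent a p.1 p.2] is Some p
  then demazure p.1 p.2 (key (mswap a p.1 p.2)) else 'X_[a].
Proof.
rewrite keyE (key_rec_fuel (leqnn _) (leqnSn _)) key_recS.
case: pickP => [p /inv1_mswap/ltnW lt|_]; last reflexivity.
by rewrite keyE (key_rec_fuel lt (leqnn _)).
Qed.

Lemma mswap_comm a i j k l : i != k -> i != l -> j != k -> j != l ->
  mswap (mswap a i j) k l = mswap (mswap a k l) i j.
Proof.
move=> ik il jk jl; apply/mnmP => x; rewrite !mnmE.
by rewrite tperm_comm.
Qed.

Lemma mswap_braid a i j k : i != j -> i != k -> j != k ->
  mswap (mswap (mswap a i j) j k) i j = mswap (mswap (mswap a j k) i j) j k.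
Proof. by move=> ij ik jk; apply/mnmP => x; rewrite !mnmE tperm_braid. Qed.

Lemma ascent_mswap a i j k l : i != k -> i != l -> j != k -> j != l ->
  ascent (mswap a k l) i j = ascent a i j.
Proof. by move=> ik il jk jl; rewrite /ascent !mnmE !tpermDn. Qed.

Lemma key_demazure a i j :
  ascent a i j -> key a = demazure i j (key (mswap a i j)).
Proof.
move: {2}#|inv1 a|.+1 (ltnSn #|inv1 a|) => N.
elim: N a i j => // N IH a i j; rewrite ltnS => aN asc_ij.
have overlap u v w : ascent a u v -> ascent a v w ->
  demazure u v (key (mswap a u v)) = demazure v w (key (mswap a v w)).
  move=> uv vw; have nuv := ascent_neq uv; have nvw := ascent_neq vw.
  case/andP: (uv) => /eqP vE auv; case/andP: (vw) => /eqP wE avw.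
  have nuw : u != w by rewrite -(inj_eq val_inj) /= wE vE; lia.
  have [nvu nwu nwv] : [/\ v != u, w != u & w != v].
    by rewrite ![_ == u]eq_sym [w == v]eq_sym.
  have Du : tperm v w u = u by exact: tpermDn.
  have Dw : tperm u v w = w by exact: tpermDn.
  have auw := ltn_trans auv avw.
  have A1 : ascent (mswap a u v) v w.
    by rewrite /ascent wE eqxx !mnmE !(Du, Dw, tpermL, tpermR) auw.
  have A2 : ascent (mswap (mswap a u v) v w) u v.
    by rewrite /ascent vE eqxx !mnmE !(Du, Dw, tpermL, tpermR) avw.
  have B1 : ascent (mswap a v w) u v.
    by rewrite /ascent vE eqxx !mnmE !(Du, Dw, tpermL, tpermR) auw.
  have B2 : ascent (mswap (mswap a v w) u v) v w.
    by rewrite /ascent wE eqxx !mnmE !(Du, Dw, tpermL, tpermR) auv.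
  have a1 := inv1_mswap uv; have b1 := inv1_mswap vw.
  have a2 := inv1_mswap A1; have b2 := inv1_mswap B1.
  rewrite (IH _ _ _ (leq_trans a1 aN) A1) (IH _ _ _ (leq_trans b1 aN) B1).
  rewrite (IH _ _ _ (leq_trans (ltnW (leq_ltn_trans a2 a1)) aN) A2).
  rewrite (IH _ _ _ (leq_trans (ltnW (leq_ltn_trans b2 b1)) aN) B2).
  rewrite (mswap_braid a nuv nuw nvw).
  exact: (demazure_braid _ nuv nuw nvw).
rewrite key_pick; case: pickP => [[k l]|/(_ (i, j))] /=; last by rewrite asc_ij.
move=> asc_kl; have [nij nkl] := (ascent_neq asc_ij, ascent_neq asc_kl).
case/andP: (asc_ij) => /eqP jE _; case/andP: (asc_kl) => /eqP lE _.
have [ik|nik] := eqVneq i k.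
  have jl : j = l by apply/val_inj; rewrite /= jE lE ik.
  by rewrite ik jl.
have njl : j != l.
  apply: contra_neq nik => jl; apply/ord_inj/succn_inj.
  by rewrite -jE -lE jl.
have [jk|njk] := eqVneq j k; first by rewrite -jk in asc_kl *; exact/esym/overlap.
have [il|nil] := eqVneq i l; first by rewrite -il in asc_kl *; exact: overlap.
have [nki nli nkj nlj] : [/\ k != i, l != i, k != j & l != j].
  by rewrite ![_ == i]eq_sym ![_ == j]eq_sym.
have A : ascent (mswap a k l) i j by rewrite ascent_mswap.
have B : ascent (mswap a i j) k l by rewrite ascent_mswap.
have a1 := inv1_mswap asc_ij; have b1 := inv1_mswap asc_kl.
rewrite (IH _ _ _ (leq_trans b1 aN) A) (IH _ _ _ (leq_trans a1 aN) B).
rewrite (mswap_comm a nik nil njk njl).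
exact/esym/(demazure_comm _ nij nkl nik nil njk njl).
Qed.

Lemma key_ascent a i j :
  ascent a i j -> key a = ddiff i j ('X_i * key (mswap a i j)).
Proof. by move/key_demazure => E; rewrite -demazureE. Qed.

Lemma key_dominant a :
  (forall i j, (i <= j)%N -> (a j <= a i)%N) -> key a = 'X_[a].
Proof.
move=> dom; rewrite key_pick; case: pickP => // [[i j]] /= /ascentW[ij].
by rewrite ltnNge dom // ltnW.
Qed.

End KeyRecursion.

(* Main.v *)
(* For a composition m let [supp m] be the indicator vector of its support and  *)
(* [pred m] be m with every positive part lowered by 1.  The key polynomial is  *)
(* a positive combination of column terms:                                      *)
(*   key a = \sum_(m in K) x^(supp m) * key (pred m),                           *)
(* where K consists of compositions m <= a in Bruhat order.  This is proved by  *)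
(* applying Demazure operators to the dominant case: for j = i + 1 the term of  *)
(* m becomes the terms of m and s_i m if m_i > 0 = m_j, vanishes if             *)
(* m_i = 0 < m_j, and becomes the term of m with m_i, m_j sorted increasingly   *)
(* otherwise.  Positivity of key a follows by induction on the largest part.    *)
(* Moreover for every b <= a some m in K satisfies supp m = supp b and b <= m,  *)
(* because sorting two adjacent parts is monotone for the Bruhat order; hence   *)
(* the support of key a increases with a, and contains supp a + (support of     *)
(* key (pred a)).  These two rules produce the exponents                        *)
(*   a + k(e_p - e_q),  a + k(e_p - e_r) + l(e_p - e_q),                        *)
(*   a + k(e_p - e_q) + l(e_r - e_s)                                            *)
(* counted by the three sums; they are pairwise distinct since the sets of      *)
(* increased and decreased coordinates determine the indices.                   *)

Require Import Defs.
From mathcomp Require Import all_boot all_order all_fingroup all_algebra.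
From mathcomp Require Import ring zify.
From mathcomp.multinomials Require Import mpoly.
Import Order.TTheory GRing.Theory Num.Theory.

Local Open Scope ring_scope.

Set Implicit Arguments.
Unset Strict Implicit.

(* Both bounds come from splitting off the first column of the diagram ([key_column_expansion]). The
   remaining factors are key polynomials with a smaller largest part, so induction on that part
   gives nonnegative coefficients ([key_ge0]). Each exponent then contributes at least 1 to the
   value at all ones, which is [theta_upper_bound].

   Nonnegativity also excludes cancellation, so exponents of single terms survive in the sum; this
   yields [msupp_key_mono] and [msupp_key_mpred]. They allow k boxes to move from row q to an
   earlier row p whenever k is at most [a q - a p]: a move by the full difference is a
   transposition, which lies below [a] in Bruhat order, and a shorter move is obtained by removing a
   column and recursing. One move, two moves into the same row and two independent moves give the
   three sums, and [changes] tells the resulting exponents apart. *)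
Opaque pswap demazure key.

(** * Demazure operators on key polynomials and on column terms *)

Section Demazure.
Context {n : nat}.
Implicit Types (f g : {mpoly int[n]}) (i j k l : 'I_n) (a b m : 'X_{1..n}).

Lemma demazure_uniq i j f g : i != j -> is_demazure i j f g -> demazure i j f = g.
Proof.
by move=> ij E; apply: (mulIf (mpolyXB_neq0 ij)); rewrite demazureP E.
Qed.

Lemma pswap_sum i j (I : Type) (r : seq I) (F : I -> {mpoly int[n]}) :
  pswap i j (\sum_(x <- r) F x) = \sum_(x <- r) pswap i j (F x).
Proof.
Transparent pswap.
rewrite /pswap; exact: raddf_sum.
Opaque pswap.
Qed.

Lemma demazure_sum i j (I : Type) (r : seq I) (F : I -> {mpoly int[n]}) :
  i != j -> demazure i j (\sum_(x <- r) F x) = \sum_(x <- r) demazure i j (F x).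
Proof.
move=> ij; apply: demazure_uniq => //; rewrite /is_demazure pswap_sum.
rewrite mulr_suml !mulr_sumr -sumrB; apply: eq_bigr => x _; exact: demazureP.
Qed.

Lemma demazure_fix i j f : i != j -> demazure i j f = f -> pswap i j f = f.
Proof. by move=> ij <-; apply: is_demazure_sym ij (demazureP _ _ _). Qed.

Lemma demazure_id i j f : i != j -> pswap i j f = f -> demazure i j f = f.
Proof.
by move=> ij E; apply: demazure_uniq; rewrite // /is_demazure E; ring.
Qed.

Lemma demazureK i j f : i != j -> demazure i j (demazure i j f) = demazure i j f.
Proof.
by move=> ij; apply: demazure_id (is_demazure_sym ij (demazureP i j f)).
Qed.

Lemma pswap_mpolyX i j m : pswap i j 'X_[m] = 'X_[mswap m i j].
Proof.
Transparent pswap.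
rewrite /pswap msymX; congr ('X_[_]); apply/mnmP => k; rewrite !mnmE.
by rewrite tpermV.
Opaque pswap.
Qed.

Lemma mswapK i j : involutive (fun a => mswap a i j).
Proof. by move=> a; apply/mnmP => k; rewrite !mnmE tpermK. Qed.

Lemma mswap_eq a i j : a i = a j -> mswap a i j = a.
Proof. by move=> E; apply/mnmP => k; rewrite mnmE; case: tpermP => [->|->|]. Qed.

Lemma mswapL a i j : mswap a i j i = a j. Proof. by rewrite mnmE tpermL. Qed.
Lemma mswapR a i j : mswap a i j j = a i. Proof. by rewrite mnmE tpermR. Qed.
Lemma mswapD a i j k : k != i -> k != j -> mswap a i j k = a k.
Proof. by move=> ki kj; rewrite mnmE tpermDn. Qed.

Lemma succ_neq i j : j = i.+1 :> nat -> i != j.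
Proof. by move=> E; rewrite -(inj_eq val_inj) /= E; lia. Qed.

Lemma key_no_ascent a : (forall i j, ~~ ascent a i j) -> key a = 'X_[a].
Proof.
by move=> na; rewrite key_pick; case: pickP => [p|//]; rewrite (negbTE (na _ _)).
Qed.

(* In the overlapping cases below, the braid relation trades the equality      *)
(* a i = a j for the same equality in a composition with fewer inversions.     *)
Lemma demazure_key_eq a i j :
  j = i.+1 :> nat -> a i = a j -> demazure i j (key a) = key a.
Proof.
move: {2}#|inv1 a|.+1 (ltnSn #|inv1 a|) => N.
elim: N a i j => // N IH a i j; rewrite ltnS => aN jE aij.
have nij := succ_neq jE.
case: (pickP (fun p : 'I_n * 'I_n => ascent a p.1 p.2)) => [[k l]|na] /=; last first.
  rewrite key_no_ascent => [|k l]; last by rewrite (na (k, l)).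
  by apply: demazure_id; rewrite // pswap_mpolyX mswap_eq.
move=> akl; case/andP: (akl) => /eqP lE akl'.
have nkl := succ_neq lE.
have lt1 := inv1_mswap akl.
have [ik|nik] := eqVneq i k.
  have jl : j = l by apply/val_inj; rewrite /= jE lE ik.
  by move: akl'; rewrite -ik -jl aij ltnn.
have njl : j != l.
  by apply: contra_neq nik => jl; apply/ord_inj/succn_inj; rewrite -jE -lE jl.
have [jk|njk] := eqVneq j k.
  rewrite -{k nik nkl}jk in akl akl' lE lt1 *.
  have nil : i != l by rewrite -(inj_eq val_inj) /= lE jE; lia.
  have nli : l != i by rewrite eq_sym.
  have nlj : l != j by rewrite eq_sym.
  set b := mswap a j l in lt1.
  have abij : ascent b i j.
    by rewrite /ascent jE eqxx mswapL mswapD // aij akl'.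
  have lt2 := inv1_mswap abij; set c := mswap b i j in lt2.
  have cE : c j = c l.
    by rewrite /c mswapR (mswapD b nli) 1?eq_sym // /b mswapR mswapD.
  rewrite (key_demazure akl) (key_demazure abij) -/b -/c.
  rewrite (demazure_braid _ nij nil njl) (IH c j l) //.
  exact: leq_trans (ltn_trans lt2 lt1) aN.
have [il|nil] := eqVneq i l.
  rewrite -{l njl nkl}il in akl akl' lE lt1 *.
  have nki : k != i by rewrite eq_sym.
  have nkj : k != j by rewrite eq_sym.
  have nji : j != i by rewrite eq_sym.
  set b := mswap a k i in lt1.
  have abij : ascent b i j.
    by rewrite /ascent jE eqxx mswapR mswapD // -aij akl'.
  have lt2 := inv1_mswap abij; set c := mswap b i j in lt2.
  have cE : c k = c i.
    by rewrite /c mswapL (mswapD b nki nkj) /b mswapL mswapD.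
  rewrite (key_demazure akl) (key_demazure abij) -/b -/c.
  rewrite -(demazure_braid _ nki nkj nij) (IH c k i) //.
  exact: leq_trans (ltn_trans lt2 lt1) aN.
rewrite (key_demazure akl) (demazure_comm _ nij nkl nik nil njk njl) IH //.
  exact: leq_trans lt1 aN.
by rewrite !mswapD.
Qed.

Definition up i j a := if (a j < a i)%N then mswap a i j else a.
Definition dn i j a := if (a i < a j)%N then mswap a i j else a.

(** A descent is the swap of an ascent, so the key recursion applies; at an ascent the operator has
    already been applied and is idempotent; a tie is [demazure_key_eq]. *)
Lemma demazure_key i j a :
  j = i.+1 :> nat -> demazure i j (key a) = key (up i j a).
Proof.
move=> jE; have nij := succ_neq jE; rewrite /up; case: ltngtP => aij.
- have A : ascent (mswap a i j) i j by rewrite /ascent jE eqxx mswapL mswapR.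
  by rewrite (key_demazure A) mswapK.
- have A : ascent a i j by rewrite /ascent jE eqxx.
  by rewrite (key_demazure A) demazureK.
- exact: demazure_key_eq.
Qed.

Lemma up_dn i j a : up i j (dn i j a) = up i j a.
Proof.
rewrite /up /dn; case: (ltnP (a i) (a j)) => // ij.
by rewrite mswapL mswapR ij mswapK ltnNge ltnW.
Qed.

Definition msupport a : 'X_{1..n} := [multinom (0 < a i)%N : nat | i < n].
Definition mpred a : 'X_{1..n} := [multinom (a i).-1 | i < n].

Lemma msupport_mpred a : a = (msupport a + mpred a)%MM.
Proof. by apply/mnmP => i; rewrite mnmDE !mnmE; lia. Qed.

Lemma msupport_swap a i j : msupport (mswap a i j) = mswap (msupport a) i j.
Proof. by apply/mnmP => k; rewrite !mnmE. Qed.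

Lemma mpred_swap a i j : mpred (mswap a i j) = mswap (mpred a) i j.
Proof. by apply/mnmP => k; rewrite !mnmE. Qed.

Definition column_term a := 'X_[msupport a] * key (mpred a).

Definition column_step i j a : seq 'X_{1..n} :=
  if (0 < a i)%N && (a j == 0)%N then [:: a; mswap a i j]
  else if (a i == 0)%N && (0 < a j)%N then [::] else [:: up i j a].

Lemma mulX_mswap i j a :
  (0 < a i)%N -> a j = 0%N ->
  'X_j * 'X_[msupport a] = 'X_i * 'X_[msupport (mswap a i j)] :> {mpoly int[n]}.
Proof.
move=> ai aj; rewrite -!mpolyXD; congr ('X_[_]); apply/mnmP => k.
have ij : i != j by apply: contraTneq ai => ->; rewrite aj.
rewrite !mnmDE !mnm1E [msupport a k]mnmE [msupport _ k]mnmE.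
have [->|nki] := eqVneq k i; first by rewrite mswapL aj ai eq_sym (negbTE ij).
have [->|nkj] := eqVneq k j; first by rewrite mswapR aj ai.
by rewrite mswapD.
Qed.

(** Writing D for the operator, a factor symmetric in the two variables passes through D, and D(x_i
    f) = x_i f + x_j D(f), which yields the two terms when [a i > 0 = a j]. When [a i = 0 < a j],
    [key (mpred a)] is symmetric and D(x_j f) = 0 for symmetric f. *)
Lemma demazure_column_term i j a :
  j = i.+1 :> nat ->
  demazure i j (column_term a) = \sum_(m <- column_step i j a) column_term m.
Proof.
move=> jE; have nij := succ_neq jE; have nji : j != i by rewrite eq_sym.
rewrite /column_step /column_term.
have Df := demazure_key (mpred a) jE.
have swapX : pswap i j 'X_[msupport a] = 'X_[msupport (mswap a i j)].
  by rewrite pswap_mpolyX msupport_swap.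
case: (posnP (a i)) => ai; case: (posnP (a j)) => aj; rewrite ?ai ?aj ?(gtn_eqF ai) ?(gtn_eqF aj) /=.
- rewrite big_seq1 /up ai aj ltnn; apply: demazure_id => //.
  have fix_f : up i j (mpred a) = mpred a by rewrite /up !mnmE ai aj.
  rewrite fix_f in Df.
  by rewrite pswapM (demazure_fix nij Df) swapX mswap_eq // ai aj.
- rewrite big_nil; apply: demazure_uniq => //.
  have fix_f : up i j (mpred a) = mpred a by rewrite /up !mnmE ai.
  rewrite fix_f in Df; rewrite /is_demazure pswapM (demazure_fix nij Df) swapX.
  have /= := @mulX_mswap j i a aj ai.
  by rewrite /mswap tpermC -/(mswap a i j) mul0r !mulrA => ->; rewrite subrr.
- rewrite big_cons big_seq1; apply: demazure_uniq => //.
  have E : 'X_j * 'X_[msupport a] = 'X_i * 'X_[msupport (mswap a i j)]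
    :> {mpoly int[n]} by exact: mulX_mswap.
  have -> : key (mpred (mswap a i j)) = demazure i j (key (mpred a)).
    rewrite Df mpred_swap /up; case: ltnP => //; rewrite !mnmE aj /= leqn0 => /eqP ai1.
    by rewrite mswap_eq // !mnmE aj ai1.
  have := demazureP i j (key (mpred a)).
  rewrite /is_demazure pswapM swapX.
  move: (demazure i j _) (pswap i j (key _)) => D s DE.
  rewrite mulrDl -['X_[_] * D * _]mulrA DE.
  move: (key _) 'X_[msupport a] 'X_[msupport (mswap a i j)] E => f M M' E.
  transitivity ('X_i * (M * f) - 'X_j * M * f + 'X_i * M' * f - 'X_j * (M' * s)).
    by ring.
  by rewrite E; ring.
- have supE : msupport (mswap a i j) = msupport a.
    by rewrite msupport_swap mswap_eq // !mnmE ai aj.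
  have fix_X : pswap i j 'X_[msupport a] = 'X_[msupport a] by rewrite swapX supE.
  have upE : up i j (mpred a) = mpred (up i j a).
    rewrite /up !mnmE -mpred_swap; have -> : ((a j).-1 < (a i).-1)%N = (a j < a i)%N by lia.
    by case: ifP.
  have supU : msupport (up i j a) = msupport a by rewrite /up; case: ifP.
  rewrite big_seq1 supU -upE -Df; apply: demazure_uniq => //.
  rewrite /is_demazure -mulrA demazureP pswapM fix_X; ring.
Qed.
End Demazure.

(** * Bruhat order through column tail counts *)

Section Bruhat.
Context {n : nat}.
Implicit Types (i j k l : 'I_n) (a b c m : 'X_{1..n}) (v s t : nat).
Local Open Scope nat_scope.

(* Number of boxes of column v + 1 of the skyline diagram in rows >= s. *)
Definition tail_count a v s := \sum_(p < n | s <= p) (v < a p).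

(** The tableau criterion for Bruhat order on the rearrangements of one composition: equality at 0
    for every [v] forces the same multiset of parts, and larger parts further down make a
    composition larger. *)
Definition bruhat b a :=
  (forall v s, tail_count b v s <= tail_count a v s) /\
  (forall v, tail_count b v 0 = tail_count a v 0).

Lemma bruhat_refl a : bruhat a a. Proof. by []. Qed.

Lemma bruhat_trans b a c : bruhat a b -> bruhat b c -> bruhat a c.
Proof.
move=> [ab ab0] [bc bc0]; split=> [v s|v]; last by rewrite ab0.
exact: leq_trans (ab v s) (bc v s).
Qed.

Lemma tail_count_ord a v i : tail_count a v i = (v < a i) + tail_count a v i.+1.
Proof.
rewrite /tail_count (bigD1 i) //=; congr (_ + _); apply: eq_bigl => p.
by rewrite [RHS]ltn_neqAle andbC eq_sym.
Qed.

Lemma tail_count_mswap a i j v s : (s <= i) = (s <= j) ->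
  tail_count (mswap a i j) v s = tail_count a v s.
Proof.
move=> sij; rewrite /tail_count (reindex_inj (@perm_inj _ (tperm i j))) /=.
apply: eq_big => [p|p _]; last by rewrite mnmE tpermK.
by case: tpermP => [->|->|//]; rewrite sij.
Qed.

(** Sorting rows i and j affects only the tail that separates them. The point of the [minn] form is
    that it is monotone in the old tail counts, so that sorting preserves Bruhat order. *)
Lemma tail_count_up i j a v s : j = i.+1 :> nat ->
  tail_count (up i j a) v s =
  if s == j then minn (tail_count a v i) (tail_count a v j.+1).+1
  else tail_count a v s.
Proof.
move=> jE; have nij := succ_neq jE; case: eqP => [->|sj]; last first.
  by rewrite /up; case: ifP => // _; apply: tail_count_mswap; lia.
rewrite (tail_count_ord a v i) -jE (tail_count_ord a v j).
rewrite (tail_count_ord (up i j a) v j).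
have -> : tail_count (up i j a) v j.+1 = tail_count a v j.+1.
  by rewrite /up; case: ifP => // _; apply: tail_count_mswap; lia.
have -> : up i j a j = maxn (a i) (a j).
  by rewrite /up; case: ifP; rewrite ?mswapR; lia.
by move: (tail_count _ _ _) => T; lia.
Qed.

Lemma tail_count_dn i j a v s : j = i.+1 :> nat ->
  tail_count (dn i j a) v s =
  if s == j then maxn (tail_count a v j.+1) (tail_count a v i).-1
  else tail_count a v s.
Proof.
move=> jE; have nij := succ_neq jE; case: eqP => [->|sj]; last first.
  by rewrite /dn; case: ifP => // _; apply: tail_count_mswap; lia.
rewrite (tail_count_ord a v i) -jE (tail_count_ord a v j).
rewrite (tail_count_ord (dn i j a) v j).
have -> : tail_count (dn i j a) v j.+1 = tail_count a v j.+1.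
  by rewrite /dn; case: ifP => // _; apply: tail_count_mswap; lia.
have -> : dn i j a j = minn (a i) (a j).
  by rewrite /dn; case: ifP; rewrite ?mswapR; lia.
by move: (tail_count _ _ _) => T; lia.
Qed.

Lemma bruhat_up i j b a :
  j = i.+1 :> nat -> bruhat b a -> bruhat (up i j b) (up i j a).
Proof.
move=> jE [le eq0]; split=> [v s|v]; rewrite !(tail_count_up _ _ _ jE).
  by case: eqP => // _; have := le v i; have := le v j.+1; lia.
by case: eqP => [|//]; lia.
Qed.

Lemma bruhat_dn i j b a :
  j = i.+1 :> nat -> bruhat b a -> bruhat (dn i j b) (dn i j a).
Proof.
move=> jE [le eq0]; split=> [v s|v]; rewrite !(tail_count_dn _ _ _ jE).
  by case: eqP => // _; have := le v i; have := le v j.+1; lia.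
by case: eqP => [|//]; lia.
Qed.

Lemma bruhat_mswap a i j : i < j -> a i < a j -> bruhat (mswap a i j) a.
Proof.
move=> ij aij; have nij : i != j by apply: contraTneq ij => ->; rewrite ltnn.
split=> [v s|v]; last by rewrite tail_count_mswap.
have [sij|sij] := eqVneq (s <= i) (s <= j); first by rewrite tail_count_mswap.
rewrite /tail_count (bigD1 j) /=; last by move: sij; lia.
rewrite [leqRHS](bigD1 j) /=; last by move: sij; lia.
rewrite mswapR; apply: leq_add; first lia.
apply: leq_sum => p /andP[sp pj]; rewrite mswapD //.
by apply: contraNneq sij => pi; move: sp; rewrite pi; lia.
Qed.

Lemma bruhat_leup a i j : j = i.+1 :> nat -> bruhat a (up i j a).
Proof.
move=> jE; rewrite /up; case: ifP => // aij.
rewrite -{1}(mswapK i j a); apply: bruhat_mswap; first by rewrite jE.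
by rewrite mswapL mswapR.
Qed.

Lemma bruhat_mpred b a : bruhat b a -> bruhat (mpred b) (mpred a).
Proof.
have E c v s : tail_count (mpred c) v s = tail_count c v.+1 s.
  by apply: eq_bigr => p _; rewrite mnmE; lia.
by move=> [le eq0]; split=> [v s|v]; rewrite !E.
Qed.

Lemma bruhat_bound N b a :
  bruhat b a -> (forall i, a i <= N) -> forall i, b i <= N.
Proof.
move=> [_ /(_ N) eq0] aN i; rewrite leqNgt; apply/negP => bi; move: eq0.
rewrite {2}/tail_count big1 => [/eqP|p _]; last by have := aN p; lia.
by rewrite sum_nat_eq0 => /forall_inP/(_ i isT); rewrite bi.
Qed.

(** The first column suffices: where [a] vanishes its whole tail vanishes, hence so does [b]. The
    supports are thus nested, and they have equal size. *)
Lemma bruhat_dominant b a : (forall i j, i <= j -> a j <= a i) ->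
  bruhat b a -> msupport b = msupport a.
Proof.
move=> dom [/(_ 0) le /(_ 0) eq0]; apply/mnmP => i; rewrite !mnmE.
have le0 k : (0 < b k) <= (0 < a k) ?= iff ((0 < b k) == (0 < a k)).
  split; last by do 2![case: (0 < _)].
  case: (posnP (a k)) => ak; last by case: (0 < b k).
  have := le k; rewrite (tail_count_ord b) {2}/tail_count big1 => [|p kp].
    by case: (0 < b k).
  by have := dom _ _ kp; rewrite ak leqn0 => /eqP ->.
have [_] := leqif_sum (fun k (_ : 0 <= k) => le0 k).
rewrite [_ == _](introT eqP eq0) => /esym/forall_inP/(_ i isT).
by move/eqP=> ->.
Qed.

End Bruhat.

(** * Column expansion, positivity and monotonicity of supports *)

Section KeySupport.
Context {n : nat}.
Implicit Types (i j k l : 'I_n) (a b c m : 'X_{1..n}).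

Lemma no_ascent_dominant a : (forall i j, ~~ ascent a i j) ->
  forall i j, (i <= j)%N -> (a j <= a i)%N.
Proof.
move=> na i j; move: {2}(j - i)%N (erefl (j - i)%N) => d.
elim: d j => [|d IH] j dE ij.
  by have -> : j = i by apply: val_inj => /=; lia.
have lt : (j.-1 < n)%N by apply: leq_ltn_trans (ltn_ord j); lia.
apply: leq_trans (IH (Ordinal lt) _ _); rewrite /=; try lia.
have := na (Ordinal lt) j; rewrite /ascent /= => /nandP[/eqP|]; lia.
Qed.

(* Along an ascent, the sorting step acts on the indexing compositions, and   *)
(* column_step only discards those whose term the Demazure operator kills.    *)
Lemma key_column_expansion a : exists K : seq 'X_{1..n},
  [/\ key a = \sum_(m <- K) column_term m,
      forall m, m \in K -> bruhat m a &
      forall b, bruhat b a ->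
        exists m, [/\ m \in K, msupport m = msupport b & bruhat b m]].
Proof.
move: {2}#|inv1 a|.+1 (ltnSn #|inv1 a|) => N.
elim: N a => // N IH a; rewrite ltnS => aN.
case: (pickP (fun p : 'I_n * 'I_n => ascent a p.1 p.2)) => [[i j]|na] /=; last first.
  have {}na i j : ~~ ascent a i j by rewrite (na (i, j)).
  have nap i j : ~~ ascent (mpred a) i j.
    by apply: contraNN (na i j); rewrite /ascent !mnmE => /andP[->]; lia.
  exists [:: a]; split=> [|m|b ba].
  - rewrite big_seq1 /column_term !key_no_ascent //.
    by rewrite -mpolyXD -msupport_mpred.
  - by rewrite inE => /eqP ->; apply: bruhat_refl.
  exists a; rewrite mem_seq1 eqxx; split=> //.
  by rewrite (bruhat_dominant (no_ascent_dominant na) ba).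
move=> aij; have [/eqP jE lt_aij] := andP aij.
have [K [KE Kle Kex]] := IH _ (leq_trans (inv1_mswap aij) aN).
have aE : up i j (mswap a i j) = a by rewrite /up mswapL mswapR lt_aij mswapK.
have dnE : dn i j a = mswap a i j by rewrite /dn lt_aij.
exists (flatten [seq column_step i j m | m <- K]); split=> [|m|b ba].
- rewrite (key_demazure aij) KE demazure_sum ?succ_neq // big_flatten big_map.
  by apply: eq_bigr => m _; rewrite demazure_column_term.
- case/flattenP=> s /mapP[m' /Kle m'le ->].
  have lea : bruhat m' a.
    by apply: bruhat_trans m'le _; rewrite -{2}aE; apply: bruhat_leup.
  have lea' : bruhat (up i j m') a by rewrite -aE; apply: bruhat_up.
  rewrite /column_step; case: ifP => [/andP[mi /eqP mj]|_].
    rewrite !inE => /orP[] /eqP -> //.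
    by rewrite /up mj mi in lea'.
  by case: ifP => // _; rewrite inE => /eqP ->.
(* The induction hypothesis is applied to [b] sorted decreasingly at i, j. Its support is that of
   [m], which excludes the killed case [m i = 0 < m j]. *)
have := bruhat_dn jE ba; rewrite dnE => /Kex[m [mK msup mle]].
have sup k : (0 < m k)%N = (0 < dn i j b k)%N.
  by have /mnmP/(_ k) := msup; rewrite !mnmE; do 2!case: (0 < _)%N.
have dnb : (dn i j b j <= dn i j b i)%N.
  by rewrite /dn; case: ltnP => //; rewrite mswapL mswapR => /ltnW.
have leup : bruhat b (up i j m).
  apply: bruhat_trans (bruhat_leup _ jE) _.
  by rewrite -up_dn; apply: bruhat_up.
have inK m' : m' \in column_step i j m ->
    m' \in flatten [seq column_step i j m0 | m0 <- K].
  by move=> m'm; apply/flattenP; exists (column_step i j m) => //; apply: map_f.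
have swapdn : dn i j b = b \/ b = mswap (dn i j b) i j.
  by rewrite /dn; case: ifP; [right; rewrite mswapK | left].
case: (posnP (m j)) => mj; first case: (posnP (m i)) => mi.
- have upm : up i j m = m by rewrite /up mi mj.
  exists m; split; last by rewrite -upm.
    by apply: inK; rewrite /column_step mi mj upm inE.
  rewrite msup; case: swapdn => [-> //|bE].
  by rewrite [in RHS]bE msupport_swap mswap_eq // !mnmE -!sup mi mj.
(* Both [m] and its swap survive here; the choice follows whether sorting moved [b]. *)
- case: swapdn => bE.
    exists m; split; [|by rewrite msup bE|by rewrite -bE].
    by apply: inK; rewrite /column_step mi mj inE eqxx.
  exists (mswap m i j); split.
  + by apply: inK; rewrite /column_step mi mj !inE eqxx orbT.
  + by rewrite [in RHS]bE !msupport_swap msup.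
  by move: leup; rewrite /up mj mi.
have mi : (0 < m i)%N by move: mj dnb; rewrite !sup; apply: leq_trans.
exists (up i j m); split=> //.
  by apply: inK; rewrite /column_step mi (gtn_eqF mj) (gtn_eqF mi) inE.
have mswap_sup : msupport (mswap m i j) = msupport m.
  by rewrite msupport_swap mswap_eq // !mnmE mi mj.
rewrite (_ : msupport (up i j m) = msupport m); last by rewrite /up; case: ifP.
case: swapdn => bE; first by rewrite msup bE.
by rewrite [in RHS]bE msupport_swap -msup -msupport_swap mswap_sup.
Qed.

(** Induction on a bound for the parts: the indices in the column expansion obey the same bound by
    [bruhat_bound], and [mpred] lowers it. *)
Lemma key_ge0 a m : 0 <= (key a)@_m.
Proof.
have [N aN] : exists N, forall i, (a i <= N)%N.
  by exists (\max_i a i)%N => i; apply: leq_bigmax.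
elim: N a aN m => [|N IH] a aN m.
  rewrite key_no_ascent ?mcoeffX // => i j; apply/negP => /ascentW[_].
  by have := aN j; lia.
have [K [-> Kle _]] := key_column_expansion a.
rewrite raddf_sum /= big_seq; apply: sumr_ge0 => c /Kle ca.
rewrite mcoeffM; apply: sumr_ge0 => p _; apply: mulr_ge0.
  by rewrite mcoeffX.
apply: IH => i; rewrite mnmE; have := bruhat_bound ca aN i; lia.
Qed.

Lemma mcoeff_column_term b m :
  (column_term b)@_(msupport b + m) = (key (mpred b))@_m.
Proof. by rewrite /column_term mulrC mcoeffMX. Qed.

Lemma column_term_ge0 b m : 0 <= (column_term b)@_m.
Proof.
rewrite mcoeffM; apply: sumr_ge0 => p _; apply: mulr_ge0; last exact: key_ge0.
by rewrite mcoeffX.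
Qed.

Lemma msupp_sum_column (K : seq 'X_{1..n}) b m : b \in K ->
  m \in msupp (key (mpred b)) ->
  (msupport b + m)%MM \in msupp (\sum_(c <- K) column_term c).
Proof.
rewrite !mcoeff_msupp => bK mb; rewrite gt_eqF // raddf_sum /=.
rewrite (perm_big _ (perm_to_rem bK)) big_cons.
apply: ltr_pwDl; last by apply: sumr_ge0 => c _; apply: column_term_ge0.
by rewrite mcoeff_column_term lt0r mb key_ge0.
Qed.

(** An exponent of [key b] comes from the column term of some c below [b], hence below [a]. The
    expansion of [key a] has an index d above c with the same support; removing the first column of
    both leaves the same question with smaller parts. *)
Lemma msupp_key_mono a b : bruhat b a -> {subset msupp (key b) <= msupp (key a)}.
Proof.
have [N aN] : exists N, forall i, (a i <= N)%N.
  by exists (\max_i a i)%N => i; apply: leq_bigmax.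
elim: N a b aN => [|N IH] a b aN ba.
  have -> // : b = a.
  by apply/mnmP => i; have := aN i; have := bruhat_bound ba aN i; lia.
have [K [-> Kle Kex]] := key_column_expansion a.
have [L [-> Lle _]] := key_column_expansion b.
move=> m /msupp_sum_le/flattenP[s /mapP[c]].
rewrite mem_filter /= => /Lle cb -> {s}.
rewrite /column_term mulrC (perm_mem (msuppMX _ _)) => /mapP[m' m'c ->].
have ca := bruhat_trans cb ba.
have [d [dK dsup cd]] := Kex c ca.
rewrite -dsup; apply: msupp_sum_column => //.
apply: IH m'c; last exact: bruhat_mpred.
by move=> i; rewrite mnmE; have := bruhat_bound (Kle d dK) aN i; lia.
Qed.

Lemma msupp_key_mpred a m : m \in msupp (key (mpred a)) ->
  (msupport a + m)%MM \in msupp (key a).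
Proof.
have [K [-> _ Kex]] := key_column_expansion a.
have [d [dK dsup ad]] := Kex a (bruhat_refl a).
move=> ma; rewrite -dsup; apply: msupp_sum_column => //.
exact: msupp_key_mono (bruhat_mpred ad) _ ma.
Qed.

Lemma msupp_key_self a : a \in msupp (key a).
Proof.
have [N aN] : exists N, forall i, (a i <= N)%N.
  by exists (\max_i a i)%N => i; apply: leq_bigmax.
elim: N a aN => [|N IH] a aN.
  rewrite key_no_ascent ?msuppX ?inE // => i j; apply/negP => /ascentW[_].
  by have := aN j; lia.
rewrite {1}(msupport_mpred a); apply: msupp_key_mpred; apply: IH => i.
by rewrite mnmE; have := aN i; lia.
Qed.

End KeySupport.

(** * Exponents obtained by moving boxes between rows *)

Section Shifts.
Context {n : nat}.
Implicit Types (i j p q r s : 'I_n) (a b : 'X_{1..n}) (k l : nat).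
Local Open Scope nat_scope.

(** The subtraction is truncated; for distinct p, q and [k <= a q] this is the vector a + k(e_p -
    e_q). *)
Definition mshift a p q k : 'X_{1..n} :=
  [multinom a i + k * (i == p) - k * (i == q) | i < n].

Lemma lt_ord_neq p q : p < q -> (p == q = false) * (q == p = false).
Proof. by move=> pq; rewrite -!val_eqE /= ltn_eqF // gtn_eqF. Qed.

Lemma mshift_full a p q : p < q -> a p < a q ->
  mshift a p q (a q - a p) = mswap a p q.
Proof.
move=> pq apq; apply/mnmP => i; rewrite !mnmE.
case: tpermP => [->|->|/eqP/negbTE -> /eqP/negbTE ->];
  rewrite ?eqxx ?(lt_ord_neq pq); lia.
Qed.

Lemma msupp_mshift a p q k : p < q -> k <= a q - a p ->
  mshift a p q k \in msupp (key a).
Proof.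
move=> pq; move: {2}(a q) (leqnn (a q)) => N.
elim: N a => [|N IH] a aN kle.
  have -> : mshift a p q k = a by apply/mnmP => i; rewrite mnmE; lia.
  exact: msupp_key_self.
have [kE|kN] := eqVneq k (a q - a p).
  have [apq|apq] := ltnP (a p) (a q).
    rewrite kE mshift_full //; apply: msupp_key_mono (bruhat_mswap pq apq) _ _.
    exact: msupp_key_self.
  have -> : mshift a p q k = a by apply/mnmP => i; rewrite mnmE; lia.
  exact: msupp_key_self.
have -> : mshift a p q k = (msupport a + mshift (mpred a) p q k)%MM.
  apply/mnmP => i; rewrite mnmDE !mnmE.
  case: (eqVneq i q) => [->|iq]; rewrite ?(lt_ord_neq pq); lia.
by apply: msupp_key_mpred; apply: IH; rewrite !mnmE; lia.
Qed.

(** When k is the full difference, swapping rows p and r raises row p to [a r], leaving room for l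
    more boxes from row q. For smaller k, removing a column keeps all strict inequalities. *)
Lemma msupp_mshift2 a p q r k l : p < q -> q < r -> a p < a r -> a r < a q ->
  0 < k <= a r - a p -> l <= a q - a r ->
  mshift (mshift a p r k) p q l \in msupp (key a).
Proof.
move=> pq qr; have pr := ltn_trans pq qr; move: {2}(a r) (leqnn (a r)) => N.
elim: N a => [|N IH] a aN apr arq kle lle; first lia.
have [->|kN] := eqVneq k (a r - a p).
  rewrite mshift_full //; apply: msupp_key_mono (bruhat_mswap pr apr) _ _.
  by apply: msupp_mshift; rewrite // mswapL mswapD ?(lt_ord_neq pq) ?(lt_ord_neq qr).
have -> : mshift (mshift a p r k) p q l =
    (msupport a + mshift (mshift (mpred a) p r k) p q l)%MM.
  apply/mnmP => i; rewrite mnmDE !mnmE.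
  case: (eqVneq i q) => [->|iq]; first by rewrite ?(lt_ord_neq pq, lt_ord_neq qr); lia.
  by case: (eqVneq i r) => [->|ir]; rewrite ?(lt_ord_neq pr);
    case: (i == p); lia.
by apply: msupp_key_mpred; apply: IH; rewrite !mnmE; lia.
Qed.

Lemma mshiftC a p q r s k l : p < q -> q < r -> r < s -> k <= a q -> l <= a s ->
  mshift (mshift a p q k) r s l = mshift (mshift a r s l) p q k.
Proof.
move=> pq qr rs kq ls; apply/mnmP => i; rewrite !mnmE.
have qs := ltn_trans qr rs; have pr := ltn_trans pq qr.
case: (eqVneq i q) => [->|iq].
  by rewrite !(lt_ord_neq pq, lt_ord_neq qr, lt_ord_neq qs); lia.
by case: (eqVneq i s) => [->|]; rewrite ?(lt_ord_neq rs);
  case: (i == p); case: (i == r); lia.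
Qed.

(** If either move is full it becomes a transposition and the other is a single shift in the swapped
    composition. If neither is full, both differences are at least 2 and survive the removal of a
    column. *)
Lemma msupp_mshift3 a p q r s k l : p < q -> q < r -> r < s ->
  a p < a q -> a r < a s -> 0 < k <= a q - a p -> 0 < l <= a s - a r ->
  mshift (mshift a p q k) r s l \in msupp (key a).
Proof.
move=> pq qr rs; have pr := ltn_trans pq qr; have qs := ltn_trans qr rs.
have ps := ltn_trans pr rs; move: {2}(a q) (leqnn (a q)) => N.
elim: N a => [|N IH] a aN apq ars kle lle; first lia.
have [->|kN] := eqVneq k (a q - a p).
  rewrite mshift_full //; apply: msupp_key_mono (bruhat_mswap pq apq) _ _.
  by apply: msupp_mshift; rewrite // !mswapD
    ?(lt_ord_neq pr, lt_ord_neq qs, lt_ord_neq ps, lt_ord_neq qr) //; lia.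
have [lE|lN] := eqVneq l (a s - a r).
  rewrite mshiftC //; try lia.
  rewrite lE mshift_full //; apply: msupp_key_mono (bruhat_mswap rs ars) _ _.
  by apply: msupp_mshift; rewrite // !mswapD
    ?(lt_ord_neq pr, lt_ord_neq qs, lt_ord_neq ps, lt_ord_neq qr) //; lia.
have -> : mshift (mshift a p q k) r s l =
    (msupport a + mshift (mshift (mpred a) p q k) r s l)%MM.
  apply/mnmP => i; rewrite mnmDE !mnmE.
  case: (eqVneq i q) => [->|iq].
    by rewrite ?(lt_ord_neq pq, lt_ord_neq qr, lt_ord_neq qs); lia.
  by case: (eqVneq i s) => [->|is_]; rewrite ?(lt_ord_neq ps, lt_ord_neq rs);
    case: (i == p); case: (i == r); lia.
by apply: msupp_key_mpred; apply: IH; rewrite !mnmE; lia.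
Qed.

(** A fingerprint of the exponent [b]: its raised and lowered rows in increasing order, from which
    the indices of the moves can be read off. *)
Definition changes a b : seq 'I_n * seq 'I_n :=
  ([seq i <- enum 'I_n | a i < b i], [seq i <- enum 'I_n | b i < a i]).

Lemma filter_enum_ord (P : pred 'I_n) (t : seq 'I_n) :
  sorted (relpre val ltn) t -> (forall i, P i = (i \in t)) ->
  [seq i <- enum 'I_n | P i] = t.
Proof.
move=> st Pt; apply: (@irr_sorted_eq _ (relpre val ltn)) => //.
- by move=> j i k; apply: ltn_trans.
- by move=> i; rewrite /= ltnn.
- apply: sorted_filter; first by move=> j i k; apply: ltn_trans.
  by rewrite -sorted_map val_enum_ord iota_ltn_sorted.
- by move=> i; rewrite mem_filter Pt mem_enum andbT.
Qed.

Lemma changes_mshift a p q k : p < q -> 0 < k -> k <= a q ->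
  changes a (mshift a p q k) = ([:: p], [:: q]).
Proof.
move=> pq k0 kq; congr pair; apply: filter_enum_ord => // i; rewrite !inE !mnmE.
- case: (eqVneq i p) => [->|ip]; rewrite ?(lt_ord_neq pq); first lia.
  case: (eqVneq i q) => _; lia.
- case: (eqVneq i q) => [->|iq]; rewrite ?(lt_ord_neq pq);
    case: (i == p); lia.
Qed.

Lemma changes_mshift2 a p q r k l : p < q -> q < r ->
  0 < k -> k <= a r -> 0 < l -> l <= a q ->
  changes a (mshift (mshift a p r k) p q l) = ([:: p], [:: q; r]).
Proof.
move=> pq qr k0 kr l0 lq; have pr := ltn_trans pq qr.
congr pair; apply: filter_enum_ord => [|i]; rewrite ?inE ?mnmE /= ?qr //.
- case: (eqVneq i p) => [->|ip]; rewrite ?(lt_ord_neq pq, lt_ord_neq pr); first lia.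
  case: (i == q); case: (i == r); lia.
- case: (eqVneq i q) => [->|iq]; first by rewrite ?(lt_ord_neq pq, lt_ord_neq qr); lia.
  case: (eqVneq i r) => [->|ir]; rewrite ?(lt_ord_neq pr);
    case: (i == p); lia.
Qed.

Lemma changes_mshift3 a p q r s k l : p < q -> q < r -> r < s ->
  0 < k -> k <= a q -> 0 < l -> l <= a s ->
  changes a (mshift (mshift a p q k) r s l) = ([:: p; r], [:: q; s]).
Proof.
move=> pq qr rs k0 kq l0 ls; have pr := ltn_trans pq qr.
have qs := ltn_trans qr rs; have ps := ltn_trans pr rs.
congr pair; apply: filter_enum_ord => [|i]; rewrite ?inE ?mnmE /= ?pr ?qs //.
- case: (eqVneq i p) => [->|ip].
    by rewrite ?(lt_ord_neq pq, lt_ord_neq pr, lt_ord_neq ps); lia.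
  case: (eqVneq i r) => [->|ir]; first by rewrite ?(lt_ord_neq qr, lt_ord_neq rs); lia.
  case: (i == q); case: (i == s); lia.
- case: (eqVneq i q) => [->|iq].
    by rewrite ?(lt_ord_neq pq, lt_ord_neq qr, lt_ord_neq qs); lia.
  case: (eqVneq i s) => [->|is_]; rewrite ?(lt_ord_neq ps, lt_ord_neq rs);
    case: (i == p); case: (i == r); lia.
Qed.

End Shifts.


(** * Counting distinct exponents, and the two bounds *)

Section Counting.
Local Open Scope nat_scope.

Lemma uniq_family (T : finType) (U W : eqType) (A : {set T}) (t : T -> seq U)
    (f : T -> U -> W) :
  (forall x, uniq (t x)) ->
  (forall x x' y y', x \in A -> x' \in A -> y \in t x -> y' \in t x' ->
     f x y = f x' y' -> x = x' /\ y = y') ->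
  uniq [seq f x y | x <- enum A, y <- t x].
Proof.
move=> tu inj; apply: allpairs_uniq_dep => [||u v]; rewrite ?enum_uniq //.
case/allpairsPdep=> x [y [xA yt ->]] /allpairsPdep[x' [y' [xA' yt' ->]]] /=.
rewrite !mem_enum in xA xA' => E.
by have [-> ->] := inj _ _ _ _ xA xA' yt yt' E.
Qed.

Lemma size_family (T : finType) (U W : Type) (A : {set T}) (t : T -> seq U)
    (f : T -> U -> W) :
  size [seq f x y | x <- enum A, y <- t x] = \sum_(x in A) size (t x).
Proof. by rewrite size_allpairs_dep sumnE big_map big_enum. Qed.

(* Signed sums in the theorem become truncated subtractions of nat, all of     *)
(* them exact by the inversion inequalities.                                    *)
Lemma theta_lower_bound (n : nat) (a : 'X_{1..n}) :
  1 + \sum_(x in inv1 a) (let: (p, q) := x in a q - a p)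
    + \sum_(x in inv2 a) (let: (p, q, r) := x in (a q - a r) * (a r - a p))
    + \sum_(x in inv3 a) (let: (p, q, r, s) := x in (a q - a p) * (a s - a r))
  <= theta a.
Proof.
pose t1 (x : 'I_n * 'I_n) := let: (p, q) := x in iota 1 (a q - a p).
pose t2 (x : 'I_n * 'I_n * 'I_n) := let: (p, q, r) := x in
  [seq (k, l) | l <- iota 1 (a q - a r), k <- iota 1 (a r - a p)].
pose t3 (x : 'I_n * 'I_n * 'I_n * 'I_n) := let: (p, q, r, s) := x in
  [seq (k, l) | k <- iota 1 (a q - a p), l <- iota 1 (a s - a r)].
pose f1 (x : 'I_n * 'I_n) k := let: (p, q) := x in mshift a p q k.
pose f2 (x : 'I_n * 'I_n * 'I_n) (y : nat * nat) := let: (p, q, r) := x in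
  mshift (mshift a p r y.1) p q y.2.
pose f3 (x : 'I_n * 'I_n * 'I_n * 'I_n) (y : nat * nat) := let: (p, q, r, s) := x in
  mshift (mshift a p q y.1) r s y.2.
pose L1 := [seq f1 x y | x <- enum (inv1 a), y <- t1 x].
pose L2 := [seq f2 x y | x <- enum (inv2 a), y <- t2 x].
pose L3 := [seq f3 x y | x <- enum (inv3 a), y <- t3 x].
have u1 : uniq L1.
  apply: uniq_family => [[p q]|[p q] [p' q'] k k']; first exact: iota_uniq.
  rewrite !inE !mem_iota /f1 => /andP[pq apq] /andP[pq' apq'] kb kb' E.
  have := congr1 (changes a) E; rewrite !changes_mshift //; try lia.
  case=> eqp eqq; subst p' q'; split=> //.
  by have /mnmP/(_ p) := E; rewrite !mnmE eqxx (lt_ord_neq pq); lia.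
have u2 : uniq L2.
  apply: uniq_family => [[[p q] r]|[[p q] r] [[p' q'] r'] y y'].
    by apply: allpairs_uniq; rewrite ?iota_uniq // => -[? ?] [? ?] _ _ [-> ->].
  rewrite !inE => /and4P[pq qr apr arq] /and4P[pq' qr' apr' arq'].
  case/allpairsP=> -[l k] [/=]; rewrite !mem_iota => lb kb -> {y}.
  case/allpairsP=> -[l' k'] [/=]; rewrite !mem_iota => lb' kb' -> {y'}.
  rewrite /f2 /= => E.
  have := congr1 (changes a) E; rewrite !changes_mshift2 //; try lia.
  case=> eqp eqq eqr; subst p' q' r'; split=> //; have pr := ltn_trans pq qr.
  have /mnmP Ei := E; have := Ei q; have := Ei r; rewrite !mnmE !eqxx.
  by rewrite !(lt_ord_neq pq, lt_ord_neq qr, lt_ord_neq pr) => E1 E2;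
    congr pair; lia.
have u3 : uniq L3.
  apply: uniq_family => [[[[p q] r] s]|[[[p q] r] s] [[[p' q'] r'] s'] y y'].
    by apply: allpairs_uniq; rewrite ?iota_uniq // => -[? ?] [? ?] _ _ [-> ->].
  rewrite !inE => /and5P[pq qr rs apq ars] /and5P[pq' qr' rs' apq' ars'].
  case/allpairsP=> -[k l] [/=]; rewrite !mem_iota => kb lb -> {y}.
  case/allpairsP=> -[k' l'] [/=]; rewrite !mem_iota => kb' lb' -> {y'}.
  rewrite /f3 /= => E.
  have := congr1 (changes a) E; rewrite !changes_mshift3 //; try lia.
  case=> eqp eqr eqq eqs; subst p' q' r' s'; split=> //.
  have qs := ltn_trans qr rs.
  have /mnmP Ei := E; have := Ei q; have := Ei s; rewrite !mnmE !eqxx.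
  by rewrite !(lt_ord_neq pq, lt_ord_neq qr, lt_ord_neq rs, lt_ord_neq qs)
    => E1 E2; congr pair; lia.
have c0 : changes a a = ([::], [::]).
  by congr pair; apply: filter_enum_ord => // i; rewrite ltnn.
(* The number of changed rows is 0 for [a] itself and 2, 3, 4 on the three families, so these are
   pairwise disjoint. *)
have m1 b : b \in L1 -> b \in msupp (key a) /\
    size (changes a b).1 + size (changes a b).2 = 2.
  case/allpairsPdep=> -[p q] [k []]; rewrite mem_enum inE mem_iota.
  case/andP=> pq apq kb ->; split; first by apply: msupp_mshift => //; lia.
  by rewrite changes_mshift //; lia.
have m2 b : b \in L2 -> b \in msupp (key a) /\
    size (changes a b).1 + size (changes a b).2 = 3.
  case/allpairsPdep=> -[[p q] r] [y []]; rewrite mem_enum inE.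
  case/and4P=> pq qr apr arq /allpairsP[[l k] [lb kb -> bE]].
  rewrite /= !mem_iota in lb kb.
  have {bE}-> : b = mshift (mshift a p r k) p q l by rewrite bE.
  by split; [apply: msupp_mshift2 | rewrite changes_mshift2] => //=; lia.
have m3 b : b \in L3 -> b \in msupp (key a) /\
    size (changes a b).1 + size (changes a b).2 = 4.
  case/allpairsPdep=> -[[[p q] r] s] [y []]; rewrite mem_enum inE.
  case/and5P=> pq qr rs apq ars /allpairsP[[k l] [kb lb -> bE]].
  rewrite /= !mem_iota in kb lb.
  have {bE}-> : b = mshift (mshift a p q k) r s l by rewrite bE.
  by split; [apply: msupp_mshift3 | rewrite changes_mshift3] => //=; lia.
have u : uniq (a :: L1 ++ L2 ++ L3).
  rewrite /= !mem_cat !cat_uniq u1 u2 u3 !andbT /=; apply/and3P; split.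
  - by apply/negP => /or3P[/m1|/m2|/m3] [_]; rewrite c0.
  - by apply/hasPn => b; rewrite mem_cat => bL; apply/negP => /m1[_];
      case/orP: bL => [/m2|/m3] [_ ->].
  - by apply/hasPn => b /m3[_ E3]; apply/negP => /m2[_]; rewrite E3.
have sub : {subset a :: L1 ++ L2 ++ L3 <= msupp (key a)}.
  move=> b; rewrite inE !mem_cat => /or4P[/eqP ->|/m1[]|/m2[]|/m3[]] //.
  exact: msupp_key_self.
apply: leq_trans (uniq_leq_size u sub).
rewrite /= !size_cat !size_family -!addnA add1n ltnS.
apply: leq_add; last apply: leq_add; apply: leq_sum.
- by case=> p q _; rewrite size_iota.
- by case=> -[p q] r _; rewrite size_allpairs !size_iota.
- by case=> -[[p q] r] s _; rewrite size_allpairs !size_iota.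
Qed.

(** The value at all ones is the sum of the coefficients, and each nonzero coefficient is a positive
    integer by [key_ge0]. *)
Lemma theta_upper_bound (n : nat) (a : 'X_{1..n}) :
  ((theta a)%:Z <= (key a).@[fun=> 1])%R.
Proof.
rewrite mevalE /theta -sum1_size (big_morph Posz PoszD (erefl 0%Z)).
rewrite big_seq [leRHS]big_seq; apply: ler_sum => m.
rewrite mcoeff_msupp => nz; rewrite big1 ?mulr1 => [|i _]; last by rewrite expr1n.
by have := key_ge0 a m; lia.
Qed.

End Counting.

Unset Implicit Arguments.

Theorem theorem1p5 (n : nat) (a : 'X_{1..n}) :
  (theta a)%:Z <= (key a).@[fun=> 1] /\
  1 + \sum_(p in inv1 a)
        (let: (i1, i2) := p in (a i2)%:Z - (a i1)%:Z)
    + \sum_(p in inv2 a)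
        (let: (i1, i2, i3) := p in
         ((a i2)%:Z - (a i3)%:Z) * ((a i3)%:Z - (a i1)%:Z))
    + \sum_(p in inv3 a)
        (let: (i1, i2, i3, i4) := p in
         ((a i2)%:Z - (a i1)%:Z) * ((a i4)%:Z - (a i3)%:Z))
  <= (theta a)%:Z.
Proof.
split; first exact: theta_upper_bound.
apply: le_trans (_ : Posz _ <= _); last by rewrite lez_nat; apply: theta_lower_bound.
rewrite !PoszD !(big_morph Posz PoszD (erefl 0%Z)) le_eqVlt.
apply/orP; left; apply/eqP.
congr (_ + _ + _ + _); apply: eq_bigr.
- case=> p q; rewrite inE => /andP[_ apq]; lia.
- case=> -[p q] r; rewrite inE => /and4P[_ _ apr arq]; rewrite PoszM; congr (_ * _); lia.
- case=> -[[p q] r] s; rewrite inE => /and5P[_ _ _ apq ars].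
  rewrite PoszM; congr (_ * _); lia.
Qed.
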